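(* Let $m\ge0$. Let $\omega_1:(m,\infty)\to(0,\omega_1(m))$ be convex and decreasing with $\omega_1(\infty)=0$, and let $\omega_2:(m,\infty)\to(0,\infty)$ be convex and increasing with $\omega_2(\infty)=\infty$. Let $1\le p<\infty$ and set $$\Psi_p(t)=\left(\omega_2^{-1}(t)\right)^{\frac1p}\ \text{ for } t>\omega_2(m),\qquad \Phi_p(t)=\frac{1}{\left(\omega_1^{-1}(t)\right)^{\frac1p}}\ \text{ for } t\in(0,\omega_1(m)),$$ together with $\Phi_p(0)=0$. If $\dfrac{1}{(\omega_1^{-1})^{1/p}}$ is concave on $(0,\omega_1(m))$, then $(\Phi_p,\Psi_p)$ is an optimal pair for the weights $(\omega_1,\omega_2)$.
   Context: The value of a function at an endpoint of its open interval of definition (possibly $\infty$) denotes the corresponding limit (possibly infinite). ''Increasing'' and ''decreasing'' are meant strictly. Standing conditions on $(\omega_1,\omega_2,\Phi,\Psi)$ for a given $m$: (A) $\omega_1:(m,\infty)\to(0,\omega_1(m))$ is convex and decreasing, $\omega_1(\infty)=0$; (B) $\omega_2:(m,\infty)\to(0,\infty)$ is convex and increasing, $\omega_2(\infty)=\infty$; (C) $\Phi:(0,\omega_1(m))\to(0,\infty)$ is concave and increasing, $\Phi(0)=0$; (D) $\Psi:(\omega_2(m),\infty)\to(0,\infty)$ is concave and increasing, $\Psi(\infty)=\infty$; (E) $1\le\Phi(\omega_1(t))\Psi(\omega_2(t))$ for all $t\in(m,\infty)$. When (A)-(E) hold, let $\delta\in(0,\omega_1(m)]$ be such that $\Phi(\delta)=\frac{1}{\Psi(\omega_2(m))}$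 if $\Psi(\omega_2(m))>0$, and $\delta=+\infty$ if $\Psi(\omega_2(m))=0$ (in which case $\omega_1(m)=+\infty$), and define $$\mathcal H_{\Phi,\Psi}(t)=\frac{1}{\Psi^{-1}\left(\frac{1}{\Phi(t)}\right)},\quad t\in(0,\delta).$$ The pair $(\Phi,\Psi)$ is called an optimal pair for the weights $(\omega_1,\omega_2)$ if (A)-(E) hold and there exist constants $C>0$ and $\varepsilon\in(0,\delta)$ such that for all $t\in(0,\varepsilon)$, $$\frac{1}{\omega_2\circ\omega_1^{-1}(t)}\le\mathcal H_{\Phi,\Psi}(t)\le\frac{C}{\omega_2\circ\omega_1^{-1}(t)}.$$ *)

(* Defs.v *)
From mathcomp Require Import all_boot all_order all_algebra.
From mathcomp Require Import all_classical all_reals all_analysis.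
Import Order.TTheory GRing.Theory Num.Theory numFieldNormedType.Exports.

Set Implicit Arguments.
Unset Strict Implicit.
Unset Printing Implicit Defensive.

Local Open Scope classical_set_scope.
Local Open Scope ring_scope.

(* The reals in the open interval (a, b), whose endpoints may be infinite. *)
Definition eoo (R : realType) (a b : \bar R) : set R :=
  [set t | (a < t%:E)%E /\ (t%:E < b)%E].

Definition increasing_on (R : realType) (D : set R) (f : R -> R) : Prop :=
  {in D &, {homo f : x y / x < y}}.

Definition decreasing_on (R : realType) (D : set R) (f : R -> R) : Prop :=
  {in D &, {homo f : x y /~ x < y}}.

Definition convex_on (R : realType) (D : set R) (f : R -> R) : Prop :=
  convex_function (D : set R^o) (f : R^o -> R^o).

Definition concave_on (R : realType) (D : set R) (f : R -> R) : Prop :=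
  convex_on D (fun t => - f t).

(* Inverse of the restriction of f to D; its values outside f @` D are junk. *)
Definition inv_on (R : realType) (D : set R) (f : R -> R) : R -> R :=
  'pinv_(fun=> 0) D f.

(* The value at a of a function defined on an open interval with lower
   endpoint a. The limit exists in \bar R for the monotone functions that
   it is applied to. *)
Definition lower_value (R : realType) (f : R -> R) (a : R) : \bar R :=
  lim ((f t)%:E @[t --> a^'+]).

(* The value at x of a function defined on an open interval with upper
   endpoint b, for x in the interval or x = b. The case b = -oo is junk. *)
Definition upper_value (R : realType) (f : R -> R) (b x : \bar R) : \bar R :=
  if (x < b)%E then (f (fine x))%:E
  else if b is r%:E then lim ((f t)%:E @[t --> r^'-])
  else lim ((f t)%:E @[t --> +oo]).

Definition weight_decr (R : realType) (m : R) (w1 : R -> R) : Prop :=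
  [/\ set_fun (eoo m%:E +oo) (eoo 0 (lower_value w1 m)) w1,
      convex_on (eoo m%:E +oo) w1,
      decreasing_on (eoo m%:E +oo) w1
    & w1 t @[t --> +oo] --> 0].

Definition weight_incr (R : realType) (m : R) (w2 : R -> R) : Prop :=
  [/\ set_fun (eoo m%:E +oo) (eoo 0 +oo) w2,
      convex_on (eoo m%:E +oo) w2,
      increasing_on (eoo m%:E +oo) w2
    & w2 t @[t --> +oo] --> +oo].

Definition cond_Phi (R : realType) (m : R) (w1 Phi : R -> R) : Prop :=
  let D := eoo 0 (lower_value w1 m) in
  [/\ set_fun D (eoo 0 +oo) Phi,
      concave_on D Phi,
      increasing_on D Phi
    & Phi t @[t --> 0^'+] --> 0].

Definition dom_Psi (R : realType) (m : R) (w2 : R -> R) : set R :=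
  eoo (lower_value w2 m) +oo.

Definition cond_Psi (R : realType) (m : R) (w2 Psi : R -> R) : Prop :=
  let D := dom_Psi m w2 in
  [/\ set_fun D (eoo 0 +oo) Psi,
      concave_on D Psi,
      increasing_on D Psi
    & Psi t @[t --> +oo] --> +oo].

Definition standing (R : realType) (m : R) (w1 w2 Phi Psi : R -> R) : Prop :=
  [/\ weight_decr m w1, weight_incr m w2, cond_Phi m w1 Phi,
      cond_Psi m w2 Psi
    & forall t, m < t -> 1 <= Phi (w1 t) * Psi (w2 t)].

(* Psi(w2(m)); w2(m) is finite since w2 is positive and increasing. *)
Definition Psi_w2m (R : realType) (m : R) (w2 Psi : R -> R) : \bar R :=
  lower_value Psi (fine (lower_value w2 m)).

(* Under the standing conditions there is exactly one such delta; the bound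
   delta <= w1(m) forces w1(m) = +oo when Psi(w2(m)) = 0. *)
Definition is_delta (R : realType) (m : R) (w1 w2 Phi Psi : R -> R)
    (delta : \bar R) : Prop :=
  [/\ (0 < delta)%E,
      (delta <= lower_value w1 m)%E,
      (0 < Psi_w2m m w2 Psi)%E ->
        upper_value Phi (lower_value w1 m) delta = ((Psi_w2m m w2 Psi)^-1)%E
    & Psi_w2m m w2 Psi = 0%E -> delta = +oo%E].

Definition calH (R : realType) (m : R) (w2 Phi Psi : R -> R) (t : R) : R :=
  (inv_on (dom_Psi m w2) Psi (Phi t)^-1)^-1.

Definition optimal_pair (R : realType) (m : R) (w1 w2 Phi Psi : R -> R) :
    Prop :=
  standing m w1 w2 Phi Psi /\
  exists2 delta : \bar R, is_delta m w1 w2 Phi Psi delta &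
  exists C eps : R,
    [/\ 0 < C, 0 < eps, (eps%:E < delta)%E
      & forall t, 0 < t -> t < eps ->
        (w2 (inv_on (eoo m%:E +oo) w1 t))^-1 <= calH m w2 Phi Psi t /\
        calH m w2 Phi Psi t <= C / w2 (inv_on (eoo m%:E +oo) w1 t)].

Definition Psi_p (R : realType) (m : R) (w2 : R -> R) (p t : R) : R :=
  inv_on (eoo m%:E +oo) w2 t `^ p^-1.

Definition Phi_p (R : realType) (m : R) (w1 : R -> R) (p t : R) : R :=
  if t == 0 then 0 else (inv_on (eoo m%:E +oo) w1 t `^ p^-1)^-1.

(* Main.v *)
(* Convex functions on (m, +oo) are continuous there, so the weights are
   bijections onto (0, w1(m)) and (w2(m), +oo). With s = w1^-1(t) one has
   1 / Phi_p(t) = s^(1/p) = Psi_p(w2(s)); this gives (E) with equality, and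
   calH(t) = 1 / w2(s), so that C = 1 works. The limit of Phi_p at w1(m) is
   m^(-1/p), which makes delta = w1(m) the right choice for m > 0; for m = 0 it
   is still admissible since concavity of Phi_p then forces w1(m) = +oo. *)
Require Import Defs.
From mathcomp Require Import all_boot all_order all_algebra.
From mathcomp Require Import all_classical all_reals all_analysis.
From mathcomp Require Import ring lra.
Import Order.TTheory GRing.Theory Num.Theory numFieldNormedType.Exports.

Local Open Scope classical_set_scope.
Local Open Scope ring_scope.

(** * Convex functions on a half-line: continuity and intermediate values *)

Lemma eooyE (R : realType) (a x : R) : eoo a%:E +oo%E x = (a < x).
Proof.
by rewrite /eoo /= propeqE lte_fin; split => [[]//|->]; split; rewrite ?ltry.
Qed.

(** Convexity at the weight (z - y) / (z - x), with denominators cleared so that later uses are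
    linear in the values of f. *)
Lemma convex_on_three_points {R : realType} {D : set R} {f : R -> R} {x y z : R} :
  convex_on D f -> D x -> D z -> x < y -> y < z ->
  (z - x) * f y <= (z - y) * f x + (y - x) * f z.
Proof.
move=> cf Dx Dz xy yz.
have zx0 : 0 < z - x by rewrite subr_gt0 (lt_trans xy).
have t0 : 0 <= (z - y) / (z - x) by rewrite divr_ge0 //; lra.
have t1 : (z - y) / (z - x) <= 1 by rewrite ler_pdivrMr // mul1r lerD2l lerN2 ltW.
have := cf (Itv01 t0 t1) x z; rewrite !inE => /(_ Dx Dz).
rewrite [X in f X](_ : _ = y); last first.
  rewrite /conv /= /unstable.onem /GRing.scale /=.
  by field; rewrite gt_eqF.
rewrite convRE /= /unstable.onem => /(ler_wpM2l (ltW zx0)); congr (_ <= _).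
by field; rewrite gt_eqF.
Qed.

(** Comparison with the chords through x - r, x and x + r gives a Lipschitz estimate at x, namely r
    |f (x + h) - f x| <= |h| K for |h| < r. *)
Lemma convex_on_continuous {R : realType} {m : R} {f : R -> R} :
  convex_on (eoo m%:E +oo%E) f -> forall x, m < x -> {for x, continuous f}.
Proof.
move=> cf x mx; pose r := (x - m) / 2.
have r0 : 0 < r by rewrite /r; lra.
have xrm : m < x - r by rewrite /r; lra.
pose K : R := `|f (x + r) - f x| + `|f (x - r) - f x|.
have K0 : 0 <= K by rewrite addr_ge0.
have tp (u v w : R) : m < u -> u < v -> v < w ->
    (w - u) * f v <= (w - v) * f u + (v - u) * f w.
  move=> mu uv vw; apply: (convex_on_three_points cf) => //; rewrite eooyE //.
  exact: lt_trans (lt_trans uv vw).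
have kp : f (x + r) - f x <= K.
  by rewrite (le_trans (ler_norm _)) // lerDl.
have km : f (x - r) - f x <= K.
  by rewrite (le_trans (ler_norm _)) // lerDr.
have lip h : `|h| < r -> r * `|f (x + h) - f x| <= `|h| * K.
  rewrite ltr_norml => /andP[hr1 hr2].
  suff [H1 H2] : r * (f (x + h) - f x) <= `|h| * K /\
         r * (f x - f (x + h)) <= `|h| * K.
    by case: (ger0P (f (x + h) - f x)) => _ //; rewrite opprB.
  case: (ltgtP h 0) => h0.
  - rewrite ltr0_norm //.
    (* This triple bounds f (x + h) from above; the next one, with x in the middle, bounds it from
       below. *)
    have := tp (x - r) (x + h) x ltac:(lra) ltac:(lra) ltac:(lra).
    have := tp (x + h) x (x + r) ltac:(lra) ltac:(lra) ltac:(lra).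
    have := ler_wpM2l (_ : 0 <= - h) kp; have := ler_wpM2l (_ : 0 <= - h) km.
    by rewrite oppr_ge0 (ltW h0) => /(_ isT) ? /(_ isT) ? ? ?; split; lra.
  - rewrite gtr0_norm //.
    have := tp x (x + h) (x + r) ltac:(lra) ltac:(lra) ltac:(lra).
    have := tp (x - r) x (x + h) ltac:(lra) ltac:(lra) ltac:(lra).
    have := ler_wpM2l (_ : 0 <= h) kp; have := ler_wpM2l (_ : 0 <= h) km.
    by rewrite (ltW h0) => /(_ isT) ? /(_ isT) ? ? ?; split; lra.
  - by rewrite h0 addr0 subrr normr0 mulr0 mul0r.
apply/cvgrPdist_lt => /= e e0.
(* K may vanish, so K + 1 serves as the divisor. *)
have K1 : 0 < K + 1 by lra.
have e1 : 0 < Num.min r (e * r / (K + 1)).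
  by rewrite lt_min r0 /=; apply: divr_gt0; [exact: mulr_gt0|].
near=> y.
have : `|y - x| < Num.min r (e * r / (K + 1)).
  by rewrite distrC; near: y; apply: cvgr_dist_lt.
rewrite lt_min => /andP[hr he].
have := lip _ hr; rewrite [x + _]addrC subrK => hl.
rewrite distrC -(ltr_pM2l r0) (le_lt_trans hl) //.
move: he; rewrite ltr_pdivlMr // => he.
apply: le_lt_trans (_ : _ <= `|y - x| * (K + 1)) _.
  by rewrite ler_wpM2l // lerDl.
by rewrite (mulrC r).
Unshelve. all: by end_near. Qed.

(** The order of a and b is left open, so that both the decreasing and the increasing weight are
    covered. *)
Lemma convex_on_IVT {R : realType} {m : R} {f : R -> R} {a b v : R} :
  convex_on (eoo m%:E +oo%E) f -> m < a -> m < b -> f a <= v -> v <= f b ->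
  exists2 c, m < c & f c = v.
Proof.
move=> cf ma mb fav vfb.
have cont c d : m < c -> {within `[c, d], continuous f}.
  move=> mc; apply: continuous_in_subspaceT => x; rewrite inE /= in_itv /=.
  move=> /andP[cx _]; exact: (convex_on_continuous cf _ (lt_le_trans mc cx)).
have hv : f a <= v <= f b by rewrite fav.
have [ab|/ltW ba] := leP a b.
- have [|c] := IVT ab (cont _ _ ma) (v := v).
    by rewrite ge_min le_max fav vfb orbT.
  by rewrite in_itv => /andP[ac _] fc; exists c => //; apply: lt_le_trans ac.
- have [|c] := IVT ba (cont _ _ mb) (v := v).
    by rewrite ge_min le_max fav vfb orbT.
  by rewrite in_itv => /andP[ac _] fc; exists c => //; apply: lt_le_trans ac.
Qed.

(* The limit from the right at m of x `^ q would not follow from continuity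
   when m = 0, hence the squeeze. *)
Lemma cvg_powR_squeeze {R : realType} {T : Type} {F : set_system T}
    {FF : Filter F} {m q : R} {g : T -> R} :
  0 <= m -> 0 < q -> (forall s, m < s -> \forall t \near F, m < g t < s) ->
  g t `^ q @[t --> F] --> m `^ q.
Proof.
move=> m0 q0 gm; apply/cvgrPdist_lt => e e0.
have mq0 := powR_ge0 m q.
pose s := (m `^ q + e) `^ q^-1.
have sq : s `^ q = m `^ q + e.
  by rewrite /s -powRrM mulVf ?gt_eqF // powRr1 // addr_ge0 // ltW.
have ms : m < s.
  rewrite ltNge; apply/negP => /(ge0_ler_powR (ltW q0)).
  by rewrite !nnegrE powR_ge0 m0 sq => /(_ isT isT); lra.
apply: filterS (gm s ms) => t /andP[mt ts].
have := gt0_ltr_powR q0 _ _ mt; rewrite !nnegrE => /(_ m0 (le_trans m0 (ltW mt))).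
have := gt0_ltr_powR q0 _ _ ts.
rewrite !nnegrE powR_ge0 (le_trans m0 (ltW mt)) sq => /(_ isT isT) ? ?.
by rewrite distrC gtr0_norm; lra.
Qed.

(** * The decreasing weight and its inverse on (0, w1(m)) *)

Section decreasing_weight.
Context {R : realType} {m : R} {w1 : R -> R}.
Hypothesis w1P : weight_decr m w1.
Let M := lower_value w1 m.
Let v1 := inv_on (eoo m%:E +oo%E) w1.

Lemma weight_decr_ltr {x y : R} : m < x -> x < y -> w1 y < w1 x.
Proof.
case: w1P => _ _ dw _ mx xy; apply: dw => //; rewrite inE eooyE //.
exact: lt_trans xy.
Qed.

Lemma weight_decr_bnd {x : R} : m < x -> 0 < w1 x /\ ((w1 x)%:E < M)%E.
Proof.
by case: w1P => sf _ _ _ mx; have := sf x; rewrite eooyE => /(_ mx) [].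
Qed.

Lemma weight_decr_invK {x : R} : m < x -> v1 (w1 x) = x.
Proof.
move=> mx; rewrite /v1 /inv_on pinvKV ?inE ?eooyE // => a b.
rewrite !inE !eooyE => ma mb ab.
case: (ltgtP a b) => // [l|l].
- by have := weight_decr_ltr ma l; rewrite ab ltxx.
- by have := weight_decr_ltr mb l; rewrite ab ltxx.
Qed.

(** Monotonicity makes the one-sided limit exist in the extended reals, so the [lim] in
    [lower_value] is a genuine limit. *)
Lemma weight_decr_cvg : (w1 t)%:E @[t --> m^'+] --> M.
Proof.
have ni : {in Interval (BRight m) (BInfty R false) &,
    nonincreasing_fun (fun t => (w1 t)%:E)}.
  move=> x y; rewrite !in_itv /= !andbT => mx my; rewrite lee_fin.
  by rewrite le_eqVlt => /predU1P[->//|/(weight_decr_ltr mx)/ltW].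
have := @nonincreasing_at_right_cvge _ _ m (BInfty R false) isT ni.
by move=> h; rewrite /M /lower_value (cvg_lim _ h).
Qed.

(** The limits at +oo and at m supply values of [w1] on both sides of y; continuity then gives a
    preimage. *)
Lemma weight_decr_inv {y : R} : 0 < y -> (y%:E < M)%E ->
  m < v1 y /\ w1 (v1 y) = y.
Proof.
move=> y0 yM; have [_ cw _ wy] := w1P.
have [a ma aY] : exists2 a, m < a & w1 a <= y.
  near (pinfty_nbhs R) => a; exists a; first by near: a; apply: nbhs_pinfty_gt; rewrite num_real.
  by apply: ltW; near: a; move/cvgr_lt : wy; apply.
have [b mb bY] : exists2 b, m < b & y <= w1 b.
  near (m^'+) => b; exists b => //.
  rewrite ltW // -lte_fin; near: b.
  exact: weight_decr_cvg (open_ereal_gt' yM).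
have [c mc <-] := convex_on_IVT cw ma mb aY bY.
by rewrite weight_decr_invK.
Unshelve. all: by end_near. Qed.

Lemma weight_decr_inv_ltr {y z : R} : 0 < y -> (z%:E < M)%E -> y < z ->
  v1 z < v1 y.
Proof.
move=> y0 zM yz.
have [my wy] := weight_decr_inv y0 (lt_trans (yz : (y%:E < z%:E)%E) zM).
have [mz wz] := weight_decr_inv (lt_trans y0 yz) zM.
case: (ltgtP (v1 z) (v1 y)) => // [l|l].
- by have := weight_decr_ltr my l; rewrite wz wy ltNge (ltW yz).
- by move: yz; rewrite -wy -wz l ltxx.
Qed.

(** Shows that [v1] tends to m as its argument increases to [M], in the form needed by
    [cvg_powR_squeeze]. *)
Lemma weight_decr_inv_lt {s z : R} : m < s -> w1 s < z -> (z%:E < M)%E ->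
  m < v1 z < s.
Proof.
move=> ms sz zM; have [ws0 _] := weight_decr_bnd ms.
have [-> _] := weight_decr_inv (lt_trans ws0 sz) zM.
by rewrite -[ltRHS](weight_decr_invK ms) weight_decr_inv_ltr.
Qed.

End decreasing_weight.

(** * The increasing weight and its inverse on (w2(m), +oo) *)

Section increasing_weight.
Context {R : realType} {m : R} {w2 : R -> R}.
Hypothesis w2P : weight_incr m w2.
Let v2 := inv_on (eoo m%:E +oo%E) w2.

Lemma weight_incr_ltr {x y : R} : m < x -> x < y -> w2 x < w2 y.
Proof.
case: w2P => _ _ iw _ mx xy; apply: iw => //; rewrite inE eooyE //.
exact: lt_trans xy.
Qed.

Lemma weight_incr_gt0 {x : R} : m < x -> 0 < w2 x.
Proof.
by case: w2P => sf _ _ _ mx; have := sf x; rewrite !eooyE => /(_ mx).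
Qed.

Lemma weight_incr_invK {x : R} : m < x -> v2 (w2 x) = x.
Proof.
move=> mx; rewrite /v2 /inv_on pinvKV ?inE ?eooyE // => a b.
rewrite !inE !eooyE => ma mb ab.
case: (ltgtP a b) => // [l|l].
- by have := weight_incr_ltr ma l; rewrite ab ltxx.
- by have := weight_incr_ltr mb l; rewrite ab ltxx.
Qed.

(** Positivity bounds [w2] from below, so its limit at m is its infimum and is finite. *)
Lemma weight_incr_lower_value : exists2 a : R, lower_value w2 m = a%:E &
  (forall x, m < x -> a < w2 x) /\ w2 t @[t --> m^'+] --> a.
Proof.
have nd : {in Interval (BRight m) (BInfty R false) &, nondecreasing_fun w2}.
  move=> x y; rewrite !in_itv /= !andbT => mx my.
  by rewrite le_eqVlt => /predU1P[->//|/(weight_incr_ltr mx)/ltW].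
have lb : has_lbound (w2 @` [set` Interval (BRight m) (BInfty R false)]).
  exists 0 => _ /= [x + <-]; rewrite in_itv /= andbT => mx.
  exact/ltW/weight_incr_gt0.
have h := @nondecreasing_at_right_cvgr _ _ m (BInfty R false) isT nd lb.
exists (inf (w2 @` [set` Interval (BRight m) (BInfty R false)])).
  by rewrite /lower_value; apply: cvg_lim => //; apply: cvg_EFin; [exact: nearW|exact: h].
split=> // x mx.
(* The infimum is at most the value at this midpoint, which is strictly below w2 x. *)
have mx2 : m < (m + x) / 2 by lra.
apply: le_lt_trans (weight_incr_ltr mx2 (_ : _ < x)); last by lra.
by apply: ge_inf => //; exists ((m + x) / 2) => //=; rewrite in_itv /= andbT.
Qed.

Lemma dom_PsiP {y : R} : dom_Psi m w2 y -> m < v2 y /\ w2 (v2 y) = y.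
Proof.
have [a aE [aw wa]] := weight_incr_lower_value.
rewrite /dom_Psi aE eooyE => ay; case: (w2P) => _ cw _ wy.
have [b mb bY] : exists2 b, m < b & y <= w2 b.
  near (pinfty_nbhs R) => b; exists b; first by near: b; apply: nbhs_pinfty_gt; rewrite num_real.
  by near: b; move/cvgryPge : wy; apply.
have [d md dY] : exists2 d, m < d & w2 d <= y.
  near (m^'+) => d; exists d => //.
  by rewrite ltW //; near: d; move/cvgr_lt : wa; apply.
have [c mc <-] := convex_on_IVT cw md mb dY bY.
by rewrite weight_incr_invK.
Unshelve. all: by end_near. Qed.

Lemma dom_Psi_weight {x : R} : m < x -> dom_Psi m w2 (w2 x).
Proof.
have [a aE [aw _]] := weight_incr_lower_value.
by rewrite /dom_Psi aE eooyE; exact: aw.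
Qed.

Lemma weight_incr_inv_ltr {y z : R} : dom_Psi m w2 y -> dom_Psi m w2 z ->
  y < z -> v2 y < v2 z.
Proof.
move=> /dom_PsiP[my wy] /dom_PsiP[mz wz] yz.
case: (ltgtP (v2 y) (v2 z)) => // [l|l].
- by have := weight_incr_ltr mz l; rewrite wz wy ltNge (ltW yz).
- by move: yz; rewrite -wy -wz l ltxx.
Qed.

End increasing_weight.

(** * Powers of the inverse weights: conditions on [Psi_p] and its value at w2(m) *)

Lemma ltr_powR_nneg {R : realType} {q x y : R} : 0 < q -> 0 <= x -> x < y ->
  x `^ q < y `^ q.
Proof.
by move=> q0 x0 xy; rewrite gt0_ltr_powR // nnegrE // (le_trans x0) // ltW.
Qed.

Section optimal_pair_power.
Context {R : realType} {m : R} {w1 w2 : R -> R} {p : R}.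
Hypotheses (m_ge0 : 0 <= m) (w1P : weight_decr m w1) (w2P : weight_incr m w2)
  (p_ge1 : 1 <= p).
Let M := lower_value w1 m.
Let v1 := inv_on (eoo m%:E +oo%E) w1.
Let v2 := inv_on (eoo m%:E +oo%E) w2.

Let p_gt0 : 0 < p. Proof. exact: lt_le_trans p_ge1. Qed.

Let pV_gt0 : 0 < p^-1. Proof. by rewrite invr_gt0. Qed.

Lemma Phi_pE {t : R} : 0 < t -> Phi_p m w1 p t = (v1 t `^ p^-1)^-1.
Proof. by move=> t0; rewrite /Phi_p gt_eqF. Qed.

Lemma powR_pK {x : R} : 0 <= x -> (x `^ p^-1) `^ p = x.
Proof. by move=> x0; rewrite -powRrM mulVf ?powRr1 // gt_eqF. Qed.

Lemma Phi_p_gt0 {t : R} : 0 < t -> (t%:E < M)%E -> 0 < Phi_p m w1 p t.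
Proof.
move=> t0 tM; rewrite Phi_pE // invr_gt0 powR_gt0 //.
by have [mt _] := weight_decr_inv w1P t0 tM; exact: le_lt_trans mt.
Qed.

Lemma Psi_p_gt0 {t : R} : dom_Psi m w2 t -> 0 < Psi_p m w2 p t.
Proof.
move=> /(dom_PsiP w2P)[mt _]; rewrite /Psi_p powR_gt0 //.
exact: le_lt_trans mt.
Qed.

Lemma Psi_p_increasing : increasing_on (dom_Psi m w2) (Psi_p m w2 p).
Proof.
move=> x y; rewrite !inE => Dx Dy xy; apply: ltr_powR_nneg => //.
  by have [mx _] := dom_PsiP w2P Dx; rewrite (le_trans m_ge0) // ltW.
exact: weight_incr_inv_ltr.
Qed.

Lemma Psi_p_weight {x : R} : m < x -> Psi_p m w2 p (w2 x) = x `^ p^-1.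
Proof. by move=> mx; rewrite /Psi_p (weight_incr_invK w2P). Qed.

Lemma Psi_p_invK {t : R} : dom_Psi m w2 t ->
  inv_on (dom_Psi m w2) (Psi_p m w2 p) (Psi_p m w2 p t) = t.
Proof.
move=> Dt; rewrite /inv_on pinvKV ?inE // => a b Da Db ab.
case: (ltgtP a b) => // l.
- by have := Psi_p_increasing _ _ Da Db l; rewrite ab ltxx.
- by have := Psi_p_increasing _ _ Db Da l; rewrite ab ltxx.
Qed.

(* Monotonicity of w2 turns its convexity into concavity of its inverse, and
   convexity of x `^ p into concavity of x `^ p^-1. *)
Lemma Psi_p_concave : concave_on (dom_Psi m w2) (Psi_p m w2 p).
Proof.
move=> t x y; rewrite !inE => Dx Dy.
have [mx wx] := dom_PsiP w2P Dx; have [my wy] := dom_PsiP w2P Dy.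
rewrite -/v2 in mx my wx wy.
have x0 : 0 <= v2 x by rewrite (le_trans m_ge0) // ltW.
have y0 : 0 <= v2 y by rewrite (le_trans m_ge0) // ltW.
pose z : R := t%:num * x + unstable.onem t%:num * y.
(* The mean of the preimages; the aim is c <= v2 z, where z is the mean of x and y. *)
pose c : R := t%:num * v2 x + unstable.onem t%:num * v2 y.
have t0 : 0 <= t%:num by [].
have t1 : 0 <= unstable.onem t%:num by rewrite unstable.onem_ge0.
have mc : m < c.
  have : 0 < c - m.
    have -> : c - m = t%:num * (v2 x - m) + unstable.onem t%:num * (v2 y - m).
      by rewrite /c /unstable.onem; ring.
    apply: (@convR_gt0 R (v2 x - m) (v2 y - m) t); by rewrite subr_gt0.
  by rewrite subr_gt0.
have wcz : w2 c <= z.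
  have [_ cw _ _] := w2P.
  by have := cw t (v2 x) (v2 y); rewrite !inE !eooyE wx wy => /(_ mx my).
have Dz : dom_Psi m w2 z.
  have [a aE [aw _]] := weight_incr_lower_value w2P.
  by rewrite /dom_Psi aE eooyE (lt_le_trans (aw _ mc)).
have cz : c <= v2 z.
  rewrite -(weight_incr_invK w2P mc); move: wcz.
  rewrite le_eqVlt => /predU1P[->//|/(weight_incr_inv_ltr w2P (dom_Psi_weight w2P mc) Dz)].
  exact: ltW.
suff : t%:num * Psi_p m w2 p x + unstable.onem t%:num * Psi_p m w2 p y
       <= Psi_p m w2 p z.
  move=> h; change (- Psi_p m w2 p z <= t%:num * - Psi_p m w2 p x
    + unstable.onem t%:num * - Psi_p m w2 p y).
  by rewrite !mulrN -opprD lerN2.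
rewrite /Psi_p -/v2; set X := v2 x `^ p^-1; set Y := v2 y `^ p^-1.
have X0 : 0 <= X by exact: powR_ge0.
have Y0 : 0 <= Y by exact: powR_ge0.
have S0 : 0 <= t%:num * X + unstable.onem t%:num * Y.
  by rewrite addr_ge0 // mulr_ge0.
(* Convexity of the p-th power, applied to the p-th roots X and Y of the preimages. *)
have hc : (t%:num * X + unstable.onem t%:num * Y) `^ p <= c.
  have := @convex_powR R p p_ge1 t X Y.
  rewrite !inE /= !in_itv /= !andbT => /(_ X0 Y0).
  by rewrite [X in _ <= X]convRE /X /Y !powR_pK.
rewrite -(@powRr1 _ (t%:num * X + _)) // -(mulfV (lt0r_neq0 p_gt0)) powRrM.
apply: ge0_ler_powR; rewrite ?nnegrE ?powR_ge0 ?(ltW pV_gt0) //.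
  by rewrite (le_trans _ cz) // (le_trans m_ge0) // ltW.
exact: le_trans cz.
Qed.

Lemma Psi_p_cvgy : Psi_p m w2 p t @[t --> +oo] --> +oo.
Proof.
apply/cvgryPge => A.
pose s := Num.max (m + 1) (`|A| `^ p).
have ms : m < s by rewrite lt_max ltrDl ltr01.
near=> t.
have st : w2 s < t.
  by near: t; apply: nbhs_pinfty_gt; rewrite num_real.
have [a aE [aw _]] := weight_incr_lower_value w2P.
have Dt : dom_Psi m w2 t by rewrite /dom_Psi aE eooyE (lt_trans (aw _ ms)).
have := Psi_p_increasing (w2 s) t; rewrite !inE.
move=> /(_ (dom_Psi_weight w2P ms) Dt st) /ltW; apply: le_trans.
rewrite Psi_p_weight // (le_trans (ler_norm A)) //.
rewrite -[leLHS]powRr1 // -(mulfV (lt0r_neq0 p_gt0)) powRrM.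
apply: ge0_ler_powR; rewrite ?nnegrE ?powR_ge0 ?(ltW pV_gt0) //.
  by rewrite (le_trans m_ge0) // ltW.
by rewrite le_max lexx orbT.
Unshelve. all: by end_near. Qed.

(** As t decreases to w2(m), [v2] t decreases to m. The value vanishes exactly when m = 0, which
    separates the two cases for delta. *)
Lemma Psi_w2m_p : Psi_w2m m w2 (Psi_p m w2 p) = (m `^ p^-1)%:E.
Proof.
have [a aE [aw _]] := weight_incr_lower_value w2P.
rewrite /Psi_w2m aE /= /lower_value; apply: cvg_lim => //.
apply: cvg_EFin; first exact: nearW.
apply: (cvg_powR_squeeze m_ge0 pV_gt0) => s ms; near=> t.
have Dt : dom_Psi m w2 t by rewrite /dom_Psi aE eooyE.
have [-> _] := dom_PsiP w2P Dt.
rewrite -[ltRHS](weight_incr_invK w2P ms) /=.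
apply: (weight_incr_inv_ltr w2P Dt (dom_Psi_weight w2P ms)).
by near: t; apply: nbhs_right_lt; exact: aw.
Unshelve. all: by end_near. Qed.

(** * Conditions on [Phi_p], its value at w1(m), and the function [calH] *)

Lemma Phi_p_increasing : increasing_on (eoo 0%E M) (Phi_p m w1 p).
Proof.
move=> x y; rewrite !inE /eoo /= !lte_fin => -[x0 xM] [y0 yM] xy.
have [my _] := weight_decr_inv w1P y0 yM.
have vy0 : 0 < v1 y by exact: le_lt_trans my.
rewrite !Phi_pE // ltf_pV2 ?posrE.
- by apply: ltr_powR_nneg; rewrite ?(ltW vy0) ?(weight_decr_inv_ltr w1P).
- by rewrite powR_gt0 // (lt_trans vy0) // (weight_decr_inv_ltr w1P).
- by rewrite powR_gt0.
Qed.

Lemma Phi_p_cvg0 : Phi_p m w1 p t @[t --> 0^'+] --> 0.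
Proof.
apply/cvgrPdist_lt => /= e e0.
pose s := Num.max (m + 1) (e^-1 `^ p).
have ms : m < s by rewrite lt_max ltrDl ltr01.
have [ws0 wsM] := weight_decr_bnd w1P ms.
near=> t.
have t0 : 0 < t by [].
have ts : t < w1 s by near: t; exact: nbhs_right_lt.
have tM : (t%:E < M)%E by apply: lt_trans wsM; rewrite lte_fin.
rewrite sub0r normrN gtr0_norm ?Phi_p_gt0 // Phi_pE // invf_plt ?posrE //; last first.
  rewrite powR_gt0 //.
  by have [mt _] := weight_decr_inv w1P t0 tM; exact: le_lt_trans mt.
have -> : e^-1 = (e^-1 `^ p) `^ p^-1.
  by rewrite -powRrM mulfV ?powRr1 ?gt_eqF // ltW // invr_gt0.
apply: ltr_powR_nneg => //; first exact: powR_ge0.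
have := weight_decr_inv_ltr w1P t0 wsM ts.
rewrite (weight_decr_invK w1P ms); apply: le_lt_trans.
by rewrite le_max lexx orbT.
Unshelve. all: by end_near. Qed.

Lemma upper_value_Phi_p :
  0 < m -> upper_value (Phi_p m w1 p) M M = ((m `^ p^-1)^-1)%:E.
Proof.
move=> m0; have m1 : m < m + 1 by rewrite ltrDl.
(* One argument for both filters approaching [M]: left neighbourhoods of a finite [M], and
   neighbourhoods of +oo. *)
have cvgPhi (F : set_system R) (FF : ProperFilter F) :
    (\forall t \near F, 0 < t /\ (t%:E < M)%E) ->
    (forall s, (s%:E < M)%E -> \forall t \near F, s < t) ->
    lim ((Phi_p m w1 p t)%:E @[t --> F]) = ((m `^ p^-1)^-1)%:E.
  move=> F0 FM; apply: cvg_lim => //.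
  apply: cvg_EFin; first exact: nearW.
  rewrite (_ : fine \o _ = Phi_p m w1 p) //.
  apply: (@cvg_trans _ ((v1 t `^ p^-1)^-1 @[t --> F])).
    apply: near_eq_cvg; apply: filterS F0 => t [t0 _].
    by rewrite Phi_pE.
  apply: cvgV; first by rewrite gt_eqF // powR_gt0.
  apply: (cvg_powR_squeeze m_ge0 pV_gt0) => s ms.
  have [_ wsM] := weight_decr_bnd w1P ms.
  apply: filterS2 F0 (FM _ wsM) => t [t0 tM] st.
  exact: (weight_decr_inv_lt w1P).
have [w0 wM] := weight_decr_bnd w1P m1.
rewrite /upper_value ltxx; case ME : M => [r| |].
- have r0 : 0 < r by move: wM; rewrite -/M ME lte_fin; exact: lt_trans.
  apply: cvgPhi => [|s]; rewrite ME.
    near=> t; split; last by rewrite lte_fin.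
    by near: t; exact: nbhs_left_gt.
  by rewrite lte_fin => sr; exact: nbhs_left_gt.
- apply: cvgPhi => [|s _].
    near=> t; split; last by rewrite ME ltry.
    by near: t; apply: nbhs_pinfty_gt; rewrite num_real.
  by apply: nbhs_pinfty_gt; rewrite num_real.
- by move: wM; rewrite -/M ME.
Unshelve. all: by end_near. Qed.

(* If M were finite, the concave function Phi_p would be bounded above near M,
   whereas it tends to +oo there. *)
Lemma concave_Phi_p_lower_valuey :
  concave_on (eoo 0%E M) (Phi_p m w1 p) -> m = 0 -> M = +oo%E.
Proof.
move=> cP mE.
have w_in (s : R) : 0 < s -> eoo 0%E M (w1 s) by rewrite -mE => /(weight_decr_bnd w1P).
have Phi_w (s : R) : 0 < s -> Phi_p m w1 p (w1 s) = (s `^ p^-1)^-1.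
  rewrite -mE => ms; have [ws0 _] := weight_decr_bnd w1P ms.
  by rewrite Phi_pE // /v1 (weight_decr_invK w1P).
have [w10 w1M] := w_in 1 ltr01.
case ME : M => [r| |] //; last by move: w1M; rewrite ME.
have wltr (s : R) : 0 < s -> 0 < w1 s /\ w1 s < r.
  by move=> /w_in[]; rewrite ME !lte_fin.
have wdec (x y : R) : 0 < x -> x < y -> w1 y < w1 x.
  by rewrite -mE; exact: weight_decr_ltr.
have two0 : 0 < 2 :> R by [].
have d0 : 0 < w1 1 - w1 2 by rewrite subr_gt0 wdec // ltr1n.
pose K := r / (w1 1 - w1 2).
have r0 : 0 < r by have [? ?] := wltr _ two0; lra.
have K0 : 0 < K by exact: divr_gt0.
(* Concavity at w1 2 < w1 1 < w1 s, where [Phi_p] is 1 at the middle point. Dropping the nonnegative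
   term in A leaves (w1 1 - w1 2) B <= w1 s - w1 2 < r. *)
have bnd (s : R) : 0 < s -> s < 1 -> (s `^ p^-1)^-1 <= K.
  move=> s0 s1.
  have := convex_on_three_points cP (w_in _ two0) (w_in _ s0)
    (wdec 1 2 ltr01 (ltr1n _ 2)) (wdec _ _ s0 s1).
  rewrite !Phi_w // powR1 invr1.
  set A := (_ `^ _)^-1; set B := (_ `^ _)^-1.
  have A0 : 0 <= A by rewrite invr_ge0 powR_ge0.
  have [? ?] := wltr _ s0; have [? ?] := wltr _ two0; have [? ?] := wltr _ ltr01.
  have := wdec _ _ s0 s1 => ?.
  have : 0 <= (w1 s - w1 1) * A by apply: mulr_ge0 => //; lra.
  by move=> ? ?; rewrite /K ler_pdivlMr //; lra.
pose s := Num.min 2^-1 ((K + 1)^-1 `^ p).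
have s0 : 0 < s by rewrite lt_min invr_gt0 two0 powR_gt0 // invr_gt0; lra.
have s1 : s < 1 by rewrite gt_min invf_lt1 ?ltr1n.
have K1 : 0 < K + 1 by lra.
have : s `^ p^-1 <= (K + 1)^-1.
  have -> : (K + 1)^-1 = ((K + 1)^-1 `^ p) `^ p^-1.
    by rewrite -powRrM mulfV ?powRr1 ?gt_eqF // invr_ge0 ltW.
  apply: ge0_ler_powR; rewrite ?nnegrE ?powR_ge0 ?(ltW pV_gt0) ?(ltW s0) //.
  by rewrite ge_min lexx orbT.
rewrite -lef_pV2 ?posrE ?invr_gt0 ?powR_gt0 // invrK => h.
by exfalso; have := le_trans h (bnd _ s0 s1); lra.
Qed.

Lemma calH_p {t : R} : 0 < t -> (t%:E < M)%E ->
  calH m w2 (Phi_p m w1 p) (Psi_p m w2 p) t = (w2 (v1 t))^-1.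
Proof.
move=> t0 tM; have [mt _] := weight_decr_inv w1P t0 tM.
rewrite /calH Phi_pE // invrK -(Psi_p_weight mt) Psi_p_invK //.
exact: dom_Psi_weight.
Qed.

End optimal_pair_power.

(** * Verification of the standing conditions and choice of delta, C and eps *)

Theorem proposition3p5 (R : realType) (m : R) (w1 w2 : R -> R) (p : R)
    (m_ge0 : 0 <= m) (w1P : weight_decr m w1) (w2P : weight_incr m w2)
    (p_ge1 : 1 <= p)
    (concP : concave_on (eoo 0%E (lower_value w1 m))
               (fun t => (inv_on (eoo m%:E +oo%E) w1 t `^ p^-1)^-1)) :
  optimal_pair m w1 w2 (Phi_p m w1 p) (Psi_p m w2 p).
Proof.
set M := lower_value w1 m in concP *.
have p0 : 0 < p by exact: lt_le_trans p_ge1.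
(* The special value at 0 is never met: x, y and their convex combinations are positive. *)
have concPhi : concave_on (eoo 0%E M) (Phi_p m w1 p).
  move=> t x y Dx Dy; have := concP t x y Dx Dy.
  move: Dx Dy; rewrite !inE /eoo /= !lte_fin => -[x0 _] [y0 _].
  rewrite !Phi_pE //; exact: convR_gt0.
have m1 : m < m + 1 by rewrite ltrDl.
have [w0 wM] := weight_decr_bnd w1P m1.
split.
  split=> //.
  - split=> //.
    + move=> t [t0 tM]; rewrite eooyE; exact: (Phi_p_gt0 m_ge0 w1P).
    + exact: (Phi_p_increasing m_ge0 w1P p_ge1).
    + exact: (Phi_p_cvg0 m_ge0 w1P p_ge1).
  - split.
    + move=> t Dt; rewrite eooyE; exact: (Psi_p_gt0 m_ge0 w2P).
    + exact: (Psi_p_concave m_ge0 w2P).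
    + exact: (Psi_p_increasing m_ge0 w2P).
    + exact: (Psi_p_cvgy m_ge0 w2P).
  - move=> t mt; have [wt0 _] := weight_decr_bnd w1P mt.
    rewrite (Psi_p_weight w2P mt) Phi_pE // (weight_decr_invK w1P mt) mulVf //.
    by rewrite gt_eqF // powR_gt0 // (le_lt_trans m_ge0).
exists M.
  split=> //.
  - by apply: lt_trans wM; rewrite lte_fin.
  - rewrite (Psi_w2m_p m_ge0 w2P) // lte_fin => mp0.
    have m0 : 0 < m by apply: gt0_powR mp0; rewrite ?invr_gt0.
    by rewrite upper_value_Phi_p // inver gt_eqF.
  - rewrite (Psi_w2m_p m_ge0 w2P) // => -[/powR_eq0_eq0 mE].
    exact: (concave_Phi_p_lower_valuey w1P p_ge1).
(* The formula for [calH] holds on all of (0, [M]), so any value of [w1] serves as eps; it is real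
   and strictly below [M] even when [M] is infinite. *)
exists 1, (w1 (m + 1)); split=> // t t0 tw.
have tM : (t%:E < M)%E by apply: lt_trans wM; rewrite lte_fin.
by rewrite (calH_p m_ge0 w1P) // div1r.
Qed.
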